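(* There exist two different measurable partitions of the unit circle $$\mathbb{T}=S_1\cup S_2\cup S_3=S_1'\cup S_2'\cup S_3',\qquad m(S_k)=m(S_k')\ \text{ for } k=1,2,3,$$ and three constant selfadjoint matrices $\Delta_1,\Delta_2,\Delta_3\in M_2$, such that if $$\Delta=\Delta_1 1_{S_1}+\Delta_2 1_{S_2}+\Delta_3 1_{S_3}\quad\text{and}\quad \Delta'=\Delta_1 1_{S_1'}+\Delta_2 1_{S_2'}+\Delta_3 1_{S_3'},$$ then $$\sum_{n\ge 1}|\widehat{\Delta}(n)|^2\ne\sum_{n\ge1}|\widehat{\Delta'}(n)|^2 .$$
   Context: $\mathbb{T}$ is the unit circle with normalized Lebesgue measure $m$. $M_2$ is the space of complex $2\times2$ matrices. For a bounded measurable $\Delta:\mathbb{T}\to M_2$, $\widehat{\Delta}(n)=\int_{\mathbb{T}}\gamma^{-n}\Delta(\gamma)\,dm(\gamma)\in M_2$. For a matrix $A$, $|A|^2=A^*A$. *)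

(* Defs.v *)
From HB Require Import structures.
From mathcomp Require Import all_boot all_order all_algebra.
From mathcomp Require Import spectral.
From mathcomp Require Import complex.
From mathcomp Require Import all_classical all_reals all_analysis measurable_realfun.

Set Implicit Arguments.
Unset Strict Implicit.
Unset Printing Implicit Defensive.

Import Order.TTheory GRing.Theory Num.Theory.
Import numFieldTopology.Exports numFieldNormedType.Exports.

Local Open Scope classical_set_scope.
Local Open Scope ring_scope.
Local Open Scope complex_scope.
Local Open Scope sesquilinear_scope.

(* mathcomp-analysis finds the norm topology on R[i]^o but not on R[i]. *)
HB.instance Definition _ (R : rcfType) := NormedModule.copy R[i] R[i]^o.

Notation borelC R := (g_sigma_algebraType (@open R[i])).

Section Circle.
Context {R : realType}.

Definition circle : set R[i] := [set z | `|z| = 1].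

Definition circle_param (t : measurableTypeR R) : borelC R :=
  cos (2 * pi * t) +i* sin (2 * pi * t).

Lemma real_complex_continuous : continuous (fun x : R => x%:C : R[i]).
Proof.
move=> x; apply/cvgrPdist_lt => e e0.
have eE : e = (complex.Re e)%:C.
  by move: e0; rewrite ltcE /=; case: e => a b /= /andP[/eqP -> _].
have re0 : 0 < complex.Re e by move: e0; rewrite eE ltcR.
have /cvgrPdist_lt/(_ _ re0) := @cvg_id _ (nbhs x).
apply: filterS => y xy.
rewrite eE -rmorphB normc_def /= expr0n addr0 sqrtr_sqr.
by rewrite ltcR.
Qed.

Lemma circle_param_continuous :
  continuous (circle_param : R -> R[i]).
Proof.
have -> : (circle_param : R -> R[i]) =
    fun t => (cos (2 * pi * t))%:C + 'i * (sin (2 * pi * t))%:C.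
  by apply/funext => t; rewrite /circle_param [LHS]complexE.
have lin : continuous (fun t : R => 2 * pi * t).
  exact: mulrl_continuous.
have ccos (t : R) : (cos (2 * pi * x))%:C @[x --> t] --> (cos (2 * pi * t))%:C.
  apply: (continuous_comp (g := fun x : R => x%:C : R[i])).
    by apply: (continuous_comp (g := cos)); [exact: lin|exact: continuous_cos].
  exact: real_complex_continuous.
have csin (t : R) : (sin (2 * pi * x))%:C @[x --> t] --> (sin (2 * pi * t))%:C.
  apply: (continuous_comp (g := fun x : R => x%:C : R[i])).
    by apply: (continuous_comp (g := sin)); [exact: lin|exact: continuous_sin].
  exact: real_complex_continuous.
move=> t; apply: cvgD; first exact: ccos.
by apply: cvgM; [exact: cvg_cst|exact: csin].
Qed.

Lemma measurable_circle_param : measurable_fun setT circle_param.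
Proof.
apply: (@measurability _ _ _ (borelC R) setT circle_param (@open R[i])) => //.
move=> _ [B oB <-].
rewrite setTI; apply: open_measurable.
by move/continuousP: circle_param_continuous; exact.
Qed.

HB.instance Definition _ :=
  isMeasurableFun.Build _ _ _ _ circle_param measurable_circle_param.

(* Normalized Lebesgue measure of the circle, as a Borel measure on the plane:
   the image of the uniform probability of [0, 1] by t |-> exp (2 pi i t). *)
Definition arc_measure : probability (borelC R) R :=
  distribution (uniform_prob (@ltr01 R)) circle_param.

Definition circle_integral (f : R[i] -> R[i]) : R[i] :=
  (\int[arc_measure]_(z in circle) complex.Re (f z)) +i*
  (\int[arc_measure]_(z in circle) complex.Im (f z)).

Definition circle_mxintegral (F : R[i] -> 'M[R[i]]_2) : 'M[R[i]]_2 :=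
  \matrix_(i, j) circle_integral (fun z => F z i j).

Definition fourier (Delta : R[i] -> 'M[R[i]]_2) (n : int) : 'M[R[i]]_2 :=
  circle_mxintegral (fun z => z ^ (- n) *: Delta z).

Definition sqabs (A : 'M[R[i]]_2) : 'M[R[i]]_2 := A^t* *m A.

Definition stepmx (D : 'I_3 -> 'M[R[i]]_2) (S : 'I_3 -> set R[i]) (z : R[i]) :
  'M[R[i]]_2 := \sum_k \1_(S k) z *: D k.

Definition fourier_partial_sum (Delta : R[i] -> 'M[R[i]]_2) (N : nat) :
  'M[R[i]]_2 := \sum_(1 <= n < N) sqabs (fourier Delta n%:Z).

Definition measurable_partition (S : 'I_3 -> set R[i]) : Prop :=
  partition setT S circle /\ forall k, measurable (S k : set (borelC R)).

End Circle.

(* Main.v *)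
(* Take Delta_3 = 0, Delta_1 = diag(1, 0) and let Delta_2 be the matrix with 1
   off the diagonal and 0 on it. The n-th Fourier coefficient of Delta is then
   [[a_n, b_n], [b_n, 0]], where a_n and b_n are the coefficients of the
   indicators of S_1 and S_2, and the upper right entry of the sum of the
   |Delta^(n)|^2 is the sum of conj(a_n) b_n. Swapping S_1 and S_2 conjugates
   this entry, so it is enough that it is not real. For S_1 and S_2 the first
   and the second quarter of the circle its imaginary part is
   - 1 / (2 pi^2) times the sum of sin(n pi / 2) / n^2, which is not 0. *)
Require Import Defs.
From mathcomp Require Import all_boot all_order all_algebra.
From mathcomp Require Import spectral complex ring lra.
From mathcomp Require Import all_classical all_reals all_analysis.
From mathcomp Require Import measurable_realfun.

Import numFieldTopology.Exports numFieldNormedType.Exports.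
Import Order.TTheory GRing.Theory Num.Theory.
Local Open Scope classical_set_scope.
Local Open Scope ring_scope.

Section Circle.
Context {R : realType}.
Local Open Scope complex_scope.
Local Notation mu := (@lebesgue_measure R).

(** * Borel measurability on the plane and powers on the circle *)

Lemma continuous_normc_contraction (f : R[i] -> R) :
  (forall z w, `|f z - f w|%:C <= `|z - w|) -> continuous f.
Proof.
move=> f_le z; have FF : Filter (nbhs z) by exact: nbhs_filter.
apply/cvgrPdist_lt => e e0.
have e0' : 0 < e%:C by rewrite ltcR.
have zw := @cvgr_dist_lt _ _ _ (nbhs z) _ (fun w : R[i] => w) z cvg_id _ e0'.
near=> w; rewrite -ltcR; apply: le_lt_trans (f_le _ _) _.
by near: w; exact: zw.
Unshelve. all: by end_near. Qed.

Lemma continuous_Re : continuous (@complex.Re R : R[i] -> R).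
Proof.
by apply: continuous_normc_contraction => z w; rewrite -raddfB normc_ge_Re.
Qed.

Lemma continuous_Im : continuous (@complex.Im R : R[i] -> R).
Proof.
apply: continuous_normc_contraction => z w; rewrite -raddfB /=.
(* Multiplication by ['i] is isometric and moves the imaginary part to the real part up to sign, so
   the bound for real parts applies. *)
have -> : complex.Im (z - w) = - complex.Re ((z - w) * 'i).
  by rewrite ReiNIm opprK.
rewrite normrN; apply: le_trans (normc_ge_Re _) _.
by rewrite normrM [X in _ * X]normc_def /= expr0n expr1n add0r sqrtr1 mulr1.
Qed.

Lemma continuous_measurable_borelC (f : R[i] -> R) : continuous f ->
  measurable_fun setT (f : borelC R -> R).
Proof.
move=> cf; apply: (measurability _ (RGenOpens.measurableE R)) => //.
move=> _ [_ [a [b ->]] <-]; rewrite setTI; apply: sub_sigma_algebra.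
by move/continuousP: cf; apply; exact: interval_open.
Qed.

(** On the circle [z ^ (- n)] equals the conjugate power, which is polynomial in the two coordinates
    and so measurable on the whole plane. Both parts go through one induction because each
    recurrence involves the other. *)
Lemma measurable_Re_conjX (n : nat) :
  measurable_fun setT (fun z : borelC R => complex.Re (z^*%C ^+ n)) /\
  measurable_fun setT (fun z : borelC R => complex.Im (z^*%C ^+ n)).
Proof.
have mRe := @continuous_measurable_borelC _ continuous_Re.
have mIm := @continuous_measurable_borelC _ continuous_Im.
elim: n => [|n [IHr IHi]].
  by split; apply: measurable_cst.
split.
  rewrite (_ : (fun _ => _) = fun z : borelC R =>
      complex.Re z * complex.Re (z^*%C ^+ n) +
      complex.Im z * complex.Im (z^*%C ^+ n)).
    by apply: measurable_funD; apply: measurable_funM.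
  apply/funext => -[x y]; rewrite exprS.
  by case: (_ ^+ n) => u v /=; rewrite mulNr opprK.
rewrite (_ : (fun _ => _) = fun z : borelC R =>
    complex.Re z * complex.Im (z^*%C ^+ n) -
    complex.Im z * complex.Re (z^*%C ^+ n)).
  by apply: measurable_funB; apply: measurable_funM.
apply/funext => -[x y]; rewrite exprS.
by case: (_ ^+ n) => u v /=; rewrite mulNr.
Qed.

Lemma conj_circle_paramX (n : nat) (t : R) :
  (circle_param t)^*%C ^+ n =
  cos (2 * pi * n%:R * t) -i* sin (2 * pi * n%:R * t).
Proof.
elim: n => [|n IH]; first by rewrite expr0 mulr0 mul0r cos0 sin0 oppr0.
rewrite exprS IH.
have -> : 2 * pi * n.+1%:R * t = 2 * pi * t + 2 * pi * n%:R * t.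
  by rewrite -natr1; ring.
by rewrite cosD sinD /circle_param; simpc; congr (_ +i* _); ring.
Qed.

Lemma circle_expN (z : R[i]) (n : nat) : circle z -> z ^ (- n%:Z) = z^*%C ^+ n.
Proof.
by move=> z1; rewrite -exprz_inv [z^-1]invc_norm z1 expr1n invr1 mul1r.
Qed.

Lemma circleE (z : R[i]) :
  circle z <-> complex.Re z ^+ 2 + complex.Im z ^+ 2 = 1.
Proof.
rewrite /circle /= -[X in X <-> _]/(`|z| = 1) normc_def; split => [[h]|->].
  have := congr1 (fun x => x ^+ 2) h.
  by rewrite sqr_sqrtr ?expr1n// addr_ge0// sqr_ge0.
by rewrite sqrtr1.
Qed.

Lemma measurable_circle : measurable (circle : set (borelC R)).
Proof.
have mRe := @continuous_measurable_borelC _ continuous_Re.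
have mIm := @continuous_measurable_borelC _ continuous_Im.
pose f (z : borelC R) := complex.Re z ^+ 2 + complex.Im z ^+ 2.
rewrite (_ : circle = setT `&` f @^-1` [set 1]).
  have mf : measurable_fun setT f.
    by apply: measurable_funD; exact: measurable_funX.
  by apply: mf => //; exact: measurable_set1.
by apply/seteqP; split => z; rewrite setTI => /circleE.
Qed.

(** * Integration against the arc measure *)

Lemma ge0_integral_arc_measure (f : borelC R -> \bar R) :
  measurable_fun setT f -> (forall z, (0 <= f z)%E) ->
  (\int[arc_measure]_z f z = \int[mu]_(t in `[0%R, 1%R]) f (circle_param t))%E.
Proof.
move=> mf f0; rewrite /arc_measure /distribution ge0_integral_pushforward//.
rewrite preimage_setT integral_uniform//=; first by rewrite subr0 invr1 mul1e.
by apply: measurableT_comp => //; exact: measurable_circle_param.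
Qed.

(** The positive and negative parts have the same integrals on both sides, so the extended real
    integrals agree even when they are infinite. *)
Lemma Rintegral_arc_measure (f : borelC R -> R) : measurable_fun setT f ->
  \int[arc_measure]_z f z = \int[mu]_(t in `[0, 1]) f (circle_param t).
Proof.
move=> mf; rewrite /Rintegral; congr fine.
have mEf : measurable_fun setT (EFin \o f) by exact/measurable_EFinP.
rewrite integralE [RHS]integralE; congr (_ - _)%E.
  rewrite ge0_integral_arc_measure//.
    by apply: eq_integral => t _; rewrite !funeposE.
  exact: measurable_funepos.
rewrite ge0_integral_arc_measure//.
  by apply: eq_integral => t _; rewrite !funenegE.
exact: measurable_funeneg.
Qed.

(** The open arc with parameters in ]a, b[. The parameters 0 and 1 give the same point of the
    circle; the strict inequalities exclude both, so the last clause is consistent on the closed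
    interval. *)
Definition arc_of (S : set R[i]) (a b : R) : Prop :=
  [/\ measurable (S : set (borelC R)), S `<=` circle, 0 <= a < b, b <= 1 &
      forall t : R, 0 <= t <= 1 -> S (circle_param t) <-> a < t < b].

Lemma arc_measure_arc S a b : arc_of S a b -> arc_measure S = (b - a)%:E.
Proof.
move=> [mS _ /andP[a0 ab] b1 Sab].
have m1 : measurable_fun setT (fun z : borelC R => (\1_S z)%:E : \bar R).
  by apply/measurable_EFinP; exact: measurable_indic.
have := integral_indic arc_measure measurableT mS; rewrite setIT => <-.
rewrite ge0_integral_arc_measure//.
transitivity (\int[mu]_(t in `[0%R, 1%R]) (\1_`]a, b[ t)%:E)%E.
  apply: eq_integral => t; rewrite inE/= in_itv/= => t01; rewrite !indicE.
  congr (_%:R%:E); congr nat_of_bool.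
  by apply/idP/idP; rewrite !inE /= in_itv /= => /(Sab _ t01).
rewrite integral_indic//= setIidl.
  by rewrite lebesgue_measure_itv/= lte_fin ab.
by move=> t; rewrite /= !in_itv/= => /andP[? ?]; apply/andP; lra.
Qed.

(** Comparing [f] with [g] on the circle only is what allows [z ^ (- n)] to be replaced there by a
    measurable conjugate power. *)
Lemma Rintegral_arc S a b (f : R[i] -> R) (g : borelC R -> R) :
  arc_of S a b -> measurable_fun setT g ->
  (forall z, circle z -> f z = g z * \1_S z) ->
  \int[arc_measure]_(z in circle) f z =
  \int[mu]_(t in `[a, b]) g (circle_param t).
Proof.
move=> [mS Sc /andP[a0 ab] b1 Sab] mg fg.
rewrite Rintegral_mkcond (_ : f \_ circle = fun z => g z * \1_S z); last first.
  apply/funext => z; rewrite patchE; case: ifPn => [|];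
    rewrite ?inE ?notin_setE.
    exact: fg.
  by move=> nz; rewrite indicE memNset ?mulr0// => /Sc.
rewrite Rintegral_arc_measure; last first.
  by apply: measurable_funM => //; exact: measurable_indic.
have mgp D : measurable_fun D (fun t : R => g (circle_param t)).
  apply: measurable_funTS; apply: (measurableT_comp mg).
  exact: measurable_circle_param.
(* The endpoints are null, and the closed interval is the form used by the fundamental theorem of
   calculus. *)
transitivity (\int[mu]_(t in `]a, b[) g (circle_param t)); last first.
  rewrite /Rintegral integral_itv_obnd_cbnd; last exact/measurable_EFinP.
  by rewrite integral_itv_bndo_bndc//; exact/measurable_EFinP.
rewrite Rintegral_mkcond [RHS]Rintegral_mkcond; apply: eq_Rintegral => t _.
rewrite !patchE indicE; case: ifPn => [|]; rewrite ?inE ?notin_setE /= in_itv/=.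
  move=> t01; have := Sab _ t01.
  by case: ifPn; rewrite ?inE ?notin_setE /= in_itv/= => tab St;
    [rewrite mem_set ?mulr1// St|rewrite memNset ?mulr0// St].
move=> t01; case: ifPn => //; rewrite inE/= in_itv/= => tab.
by exfalso; apply: t01; lra.
Qed.

(** * Integrals of cosine and sine, and Fourier coefficients of an arc *)

Lemma is_derive_scaled (f df : R -> R) (w t : R) :
  (forall x : R, is_derive x 1 f (df x)) ->
  is_derive t 1 (fun x => f (w * x)) (w * df (w * t)).
Proof.
move=> fdf; have h : is_derive t 1 (fun x : R => w * x) w.
  by apply: is_derive_eq; rewrite /GRing.scale /=; ring.
have fwt := fdf (w * t).
by apply: is_derive_eq (is_derive1_comp fwt h) _; rewrite /GRing.scale /= mulrC.
Qed.

Lemma Rintegral_derive (F f : R -> R) (a b : R) : a < b ->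
  (forall t : R, is_derive t 1 F (f t)) -> continuous f ->
  \int[mu]_(t in `[a, b]) f t = F b - F a.
Proof.
move=> ab dF cf; have cF : continuous F.
  move=> t; apply/differentiable_continuous/derivable1_diffP.
  by have [] := dF t.
rewrite /Rintegral (@continuous_FTC2 _ _ F)//.
- by apply: continuous_in_subspaceT => t _; exact: cf.
- split.
  + by move=> t _; have [] := dF t.
  + by apply: cvg_at_right_filter; exact: cF.
  + by apply: cvg_at_left_filter; exact: cF.
- by move=> t _; rewrite derive1E; have [] := dF t.
Qed.

Lemma continuous_scaled (f : R -> R) (w : R) : continuous f ->
  continuous (fun t : R => f (w * t)).
Proof.
move=> cf t; apply: (continuous_comp (g := f)); last exact: cf.
exact: mulrl_continuous.
Qed.

Lemma Rintegral_cos (w a b : R) : w != 0 -> a < b ->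
  \int[mu]_(t in `[a, b]) cos (w * t) = (sin (w * b) - sin (w * a)) / w.
Proof.
move=> w0 ab.
have dF (t : R) : is_derive t 1 (fun t => w^-1 * sin (w * t)) (cos (w * t)).
  have h := @is_derive_scaled _ _ w t (@is_derive_sin R).
  by apply: is_derive_eq; rewrite /GRing.scale/= mulKf.
rewrite (@Rintegral_derive _ _ _ _ ab dF); first by field.
exact/continuous_scaled/continuous_cos.
Qed.

Lemma Rintegral_Nsin (w a b : R) : w != 0 -> a < b ->
  \int[mu]_(t in `[a, b]) - sin (w * t) = (cos (w * b) - cos (w * a)) / w.
Proof.
move=> w0 ab.
have dF (t : R) : is_derive t 1 (fun t => w^-1 * cos (w * t)) (- sin (w * t)).
  have h := @is_derive_scaled _ _ w t (@is_derive_cos R).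
  by apply: is_derive_eq; rewrite /GRing.scale/= mulKf.
rewrite (@Rintegral_derive _ _ _ _ ab dF); first by field.
by move=> t; apply: cvgN; apply: (@continuous_scaled sin w (@continuous_sin R)).
Qed.

(** With w = 2 pi n, the integrand along the parametrization is cos (w t) - i sin (w t), whose
    primitives are sin (w t) / w and cos (w t) / w. *)
Lemma circle_integral_arc S a b (n : nat) : arc_of S a b -> (0 < n)%N ->
  circle_integral (fun z => z ^ (- n%:Z) * \1_S z) =
  ((sin (2 * pi * n%:R * b) - sin (2 * pi * n%:R * a)) / (2 * pi * n%:R)) +i*
  ((cos (2 * pi * n%:R * b) - cos (2 * pi * n%:R * a)) / (2 * pi * n%:R)).
Proof.
move=> Sab n0; have [_ _ /andP[_ ab] _ _] := Sab.
have [mr mi] := measurable_Re_conjX n.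
have w0 : 2 * pi * n%:R != 0 :> R.
  by rewrite !mulf_neq0// ?pnatr_eq0 -?lt0n// gt_eqF// pi_gt0.
have indE z : (\1_S z : R[i]) = (\1_S z : R)%:C.
  by rewrite !indicE rmorph_nat.
congr (_ +i* _).
  rewrite (@Rintegral_arc _ _ _ _ _ Sab mr); last first.
    move=> z z1; rewrite circle_expN// indE.
    by case: (_ ^+ n) => x y; rewrite /= mulr0 subr0.
  rewrite -Rintegral_cos//; apply: eq_Rintegral => t _.
  by rewrite conj_circle_paramX.
rewrite (@Rintegral_arc _ _ _ _ _ Sab mi); last first.
  move=> z z1; rewrite circle_expN// indE.
  by case: (_ ^+ n) => x y; rewrite /= mulr0 add0r.
rewrite -Rintegral_Nsin//; apply: eq_Rintegral => t _.
by rewrite conj_circle_paramX.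
Qed.

(** * The first two quadrants as arcs *)

Lemma sin_2pi_gt0 (t : R) : 0 <= t <= 1 ->
  (0 < sin (2 * pi * t)) = (0 < t < 1 / 2).
Proof.
move=> /andP[t0 t1]; have pi0 := pi_gt0 R.
apply/idP/idP => [s0|/andP[t0' t1']]; last first.
  by apply: sin_gt0_pi; apply/andP; split; nra.
apply/andP; split.
  rewrite lt_neqAle t0 andbT eq_sym; apply: contraTneq s0 => ->.
  by rewrite mulr0 sin0 ltxx.
rewrite ltNge; apply: contraTN s0 => th; rewrite -leNgt.
have -> : 2 * pi * t = (2 * pi * t - pi) + pi by ring.
by rewrite sinDpi oppr_le0; apply: sin_ge0_pi; apply/andP; split; nra.
Qed.

Lemma cos_2pi_gt0 (t : R) : 0 < t < 1 / 2 ->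
  (0 < cos (2 * pi * t)) = (t < 1 / 4).
Proof.
move=> /andP[t0 t1]; have pi0 := pi_gt0 R.
apply/idP/idP => [c0|t4]; last by apply: cos_gt0_pihalf; apply/andP; split; nra.
rewrite ltNge; apply: contraTN c0 => th; rewrite -leNgt.
have -> : 2 * pi * t = (2 * pi * t - pi) + pi by ring.
by rewrite cosDpi oppr_le0; apply: cos_ge0_pihalf; apply/andP; split; nra.
Qed.

Lemma cos_2pi_lt0 (t : R) : 0 < t < 1 / 2 ->
  (cos (2 * pi * t) < 0) = (1 / 4 < t).
Proof.
move=> /andP[t0 t1]; have pi0 := pi_gt0 R.
(* The reflection t -> 1/2 - t about the imaginary axis reduces this to the positive case. *)
have -> : 2 * pi * t = pi - 2 * pi * (1 / 2 - t) by field.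
rewrite addrC cosDpi cosN oppr_lt0 cos_2pi_gt0; first by apply/idP/idP; lra.
by apply/andP; lra.
Qed.

(** Sign conditions make measurability immediate. They are strict, so the points on the axes are
    left to the third set of the partition. *)
Definition quadrant1 : set R[i] :=
  [set z | [/\ circle z, 0 < complex.Re z & 0 < complex.Im z]].

Definition quadrant2 : set R[i] :=
  [set z | [/\ circle z, complex.Re z < 0 & 0 < complex.Im z]].

Lemma circle_circle_param (t : R) : circle (circle_param t).
Proof. by apply/circleE; rewrite /= cos2Dsin2. Qed.

Lemma arc_of_quadrant1 : arc_of quadrant1 0 (1 / 4).
Proof.
have mRe := @continuous_measurable_borelC _ continuous_Re.
have mIm := @continuous_measurable_borelC _ continuous_Im.
split=> [|z []//||  |t t01]; [|lra|lra|].
- rewrite (_ : quadrant1 = circle `&`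
      (setT `&` @complex.Re R @^-1` `]0, +oo[) `&`
      (setT `&` @complex.Im R @^-1` `]0, +oo[)).
    apply: measurableI; last by apply: mIm => //.
    by apply: measurableI; [exact: measurable_circle|apply: mRe].
  by apply/seteqP; split => z /=; rewrite !in_itv /= !andbT;
    [move=> [? ? ?]|move=> [[? [_ ?]] [_ ?]]].
- split=> [[_ /= c0]|/andP[t0 t1]].
    by rewrite sin_2pi_gt0// => t0; move: c0; rewrite cos_2pi_gt0//; lra.
  have t2 : 0 < t < 1 / 2 by lra.
  split; first exact: circle_circle_param.
    by rewrite /= cos_2pi_gt0.
  by rewrite /= sin_2pi_gt0.
Qed.

Lemma arc_of_quadrant2 : arc_of quadrant2 (1 / 4) (1 / 2).
Proof.
have mRe := @continuous_measurable_borelC _ continuous_Re.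
have mIm := @continuous_measurable_borelC _ continuous_Im.
split=> [|z []//||  |t t01]; [|lra|lra|].
- rewrite (_ : quadrant2 = circle `&`
      (setT `&` @complex.Re R @^-1` `]-oo, 0[) `&`
      (setT `&` @complex.Im R @^-1` `]0, +oo[)).
    apply: measurableI; last by apply: mIm => //.
    by apply: measurableI; [exact: measurable_circle|apply: mRe].
  by apply/seteqP; split => z /=; rewrite !in_itv /= !andbT;
    [move=> [? ? ?]|move=> [[? [_ ?]] [_ ?]]].
- split=> [[_ /= c0]|/andP[t0 t1]].
    by rewrite sin_2pi_gt0// => t0; move: c0; rewrite cos_2pi_lt0//; lra.
  have t2 : 0 < t < 1 / 2 by lra.
  split; first exact: circle_circle_param.
    by rewrite /= cos_2pi_lt0.
  by rewrite /= sin_2pi_gt0.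
Qed.

(** * Entrywise limits of matrices and complex sequences *)

Lemma cvgn_mx (m n : nat) (T : ptopologicalType) (M : nat -> 'M[T]_(m, n))
    (L : 'M[T]_(m, n)) :
  (forall i j, M k i j @[k --> \oo] --> L i j) -> M @ \oo --> L.
Proof.
(* A neighbourhood of [L] contains a box of entrywise neighbourhoods [P i j], and there are finitely
   many entries. *)
move=> cM A [P nbhsP PA].
suff : \forall k \near \oo, forall i j, P i j (M k i j).
  by apply: filterS => k Pk; exact: PA.
apply: filter_forall => i; apply: filter_forall => j.
exact: (cM i j _ (nbhsP i j)).
Qed.

Lemma cvgn_mx_entry (m n : nat) (T : ptopologicalType) (M : nat -> 'M[T]_(m, n))
    (L : 'M[T]_(m, n)) i j :
  M @ \oo --> L -> M k i j @[k --> \oo] --> L i j.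
Proof.
move=> cM A nA; apply: (cM [set N : 'M[T]_(m, n) | A (N i j)]).
(* This box constrains the entry at (i, j) only. *)
exists (fun i' j' => [set x | i' = i -> j' = j -> A x]).
  move=> i' j'; have [[-> ->]|nij] := pselect (i' = i /\ j' = j).
    by apply: filterS nA => x Ax _ _.
  by apply: (filterS _ filterT) => x _ ii jj; case: nij.
by move=> N; apply.
Qed.

Lemma cvgn_complex (u v : nat -> R) (a b : R) :
  u @ \oo --> a -> v @ \oo --> b ->
  (u k +i* v k) @[k --> \oo] --> (a +i* b : R[i]).
Proof.
move=> ua vb.
have cC (w : nat -> R) (l : R) : w @ \oo --> l ->
    (w k)%:C @[k --> \oo] --> (l%:C : R[i]).
  move=> wl; apply: (cvg_comp w (fun x : R => x%:C : R[i]) wl).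
  exact: real_complex_continuous.
rewrite [a +i* b]complexE.
under eq_cvg do rewrite [_ +i* _]complexE.
by apply: cvgD; [exact: cC|apply: cvgM; [exact: cvg_cst|exact: cC]].
Qed.

(** * Series dominated by the inverse squares *)

Lemma sum_inv_sqr_le (N : nat) :
  \sum_(1 <= n < N.+1) (n%:R ^- 2 : R) <= 2 - 2 / N.+1%:R.
Proof.
elim: N => [|N IH]; first by rewrite big_geq// divr1 subrr.
rewrite big_nat_recr//=; apply: (le_trans (lerD IH (lexx _))).
set x : R := N.+1%:R; have x1 : 1 <= x by rewrite ler1n.
rewrite -[N.+2%:R]natr1 -/x -subr_ge0.
(* The bound telescopes because 1 / x^2 <= 2 / x - 2 / (x + 1) for x >= 1. *)
have -> : 2 - 2 / (x + 1) - (2 - 2 / x + x ^- 2) =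
    (x - 1) / (x ^+ 2 * (x + 1)) by field; apply/andP; split; lra.
by apply: divr_ge0; nra.
Qed.

Lemma cvgn_sum_le_inv_sqr (u : nat -> R) (K : R) :
  (forall n, (0 < n)%N -> `|u n| <= K * n%:R ^- 2) ->
  cvgn (fun N => \sum_(1 <= n < N) u n).
Proof.
(* [series] starts at index 0 and the sum at 1, hence the shift. *)
move=> ule; suff /cvg_ex[l ul] : cvgn (series (fun n => u n.+1)).
  apply/cvg_ex; exists l; rewrite -cvg_shiftS.
  by rewrite (_ : (fun _ => _) = series (fun n => u n.+1))//;
    apply/funext => N; rewrite big_add1.
apply: normed_cvg.
apply: (series_le_cvg (v_ := K *: (fun n => (n.+1%:R ^- 2 : R)))) => [n|n|n|].
- exact: normr_ge0.
- exact: le_trans (normr_ge0 _) (ule n.+1 isT).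
- exact: ule.
apply: is_cvg_seriesZ; apply: nondecreasing_is_cvgn.
  by apply: nondecreasing_series => n _ _; rewrite invr_ge0 exprn_ge0.
exists 2 => _ [N _ <-]; have := sum_inv_sqr_le N; rewrite big_add1 => h.
by apply: le_trans h _; rewrite gerBl divr_ge0.
Qed.

(** * A lower bound for the sine series *)

Lemma sin_mul_cos_pihalf (n : nat) :
  sin (pi / 2 * n%:R) * cos (pi / 2 * n%:R) = 0 :> R.
Proof.
elim: n => [|n IH]; first by rewrite mulr0 sin0 mul0r.
(* A shift by pi / 2 turns (sin, cos) into (cos, - sin), so the product only changes sign. *)
rewrite -[n.+1%:R]natr1 mulrDr mulr1 sinDpihalf cosDpihalf mulrN mulrC.
by rewrite IH oppr0.
Qed.

(* The terms n = 1 and n = 2 are 1 and 0; the later ones are at least -1 / n^2,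
   which is at least 1 / n - 1 / (n - 1), and these telescope. *)
Lemma sum_sin_pihalf_ge (N : nat) : 1 / 2 + N.+2%:R^-1 <=
  \sum_(1 <= n < N.+3) sin (pi / 2 * n%:R) / n%:R ^+ 2 :> R.
Proof.
elim: N => [|N IH].
  rewrite big_nat_recr//= big_nat1 mulr1 sin_pihalf expr1n.
  have -> : pi / 2 * 2 = pi :> R by field.
  by rewrite sinpi; lra.
rewrite big_nat_recr//=; move: IH; set S := \sum_(_ <= _ < _) _ => IH.
rewrite -[N.+3%:R]natr1; set x : R := N.+2%:R.
have x2 : 2 <= x by rewrite ler_nat.
have : - (x + 1) ^- 2 <= sin (pi / 2 * (x + 1)) / (x + 1) ^+ 2.
  rewrite -mulN1r ler_wpM2r ?sin_geN1// invr_ge0 exprn_ge0//; lra.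
have : (x + 1)^-1 <= x^-1 - (x + 1) ^- 2.
  rewrite -subr_ge0.
  have -> : x^-1 - (x + 1) ^- 2 - (x + 1)^-1 = (x * (x + 1) ^+ 2)^-1.
    by field; apply/andP; split; lra.
  by rewrite invr_ge0; nra.
move=> h1 h2; apply: (le_trans _ (lerD IH h2));
by rewrite -/x; move: h1;
  move: (x^-1) ((x + 1)^-1) ((x + 1) ^- 2) => a b c; lra.
Qed.

Lemma cvgn_sum_mx (F : nat -> 'M[R[i]]_2) (K : R) :
  (forall n i j, (0 < n)%N -> `|complex.Re (F n i j)| <= K * n%:R ^- 2) ->
  (forall n i j, (0 < n)%N -> `|complex.Im (F n i j)| <= K * n%:R ^- 2) ->
  cvgn (fun N => \sum_(1 <= n < N) F n).
Proof.
move=> Fr Fi.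
have cr i j :=
  @cvgn_sum_le_inv_sqr (fun n => complex.Re (F n i j)) _ (Fr ^~ i ^~ j).
have ci i j :=
  @cvgn_sum_le_inv_sqr (fun n => complex.Im (F n i j)) _ (Fi ^~ i ^~ j).
apply/cvg_ex; exists (\matrix_(i, j)
  (limn (fun N => \sum_(1 <= n < N) complex.Re (F n i j)) +i*
   limn (fun N => \sum_(1 <= n < N) complex.Im (F n i j)))).
apply: cvgn_mx => i j; rewrite mxE.
rewrite (_ : (fun _ => _) = fun N =>
    (\sum_(1 <= n < N) complex.Re (F n i j)) +i*
    (\sum_(1 <= n < N) complex.Im (F n i j))).
  exact: cvgn_complex (cr i j) (ci i j).
apply/funext => N; rewrite summxE; apply/eqP.
by rewrite eq_complex /= !raddf_sum !eqxx.
Qed.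

(** * The partitions and their matrix-valued step functions *)

Definition sym2 (a b : R[i]) : 'M[R[i]]_2 := \matrix_(i, j)
  match val i, val j with 0%N, 0%N => a | 1%N, 1%N => 0 | _, _ => b end.

Definition parts (A B : set R[i]) (k : 'I_3) : set R[i] :=
  match val k with 0%N => A | 1%N => B | _ => circle `\` (A `|` B) end.

Definition coefs (k : 'I_3) : 'M[R[i]]_2 :=
  match val k with 0%N => sym2 1 0 | 1%N => sym2 0 1 | _ => sym2 0 0 end.

Lemma coefs_hermsym k : coefs k \is hermsymmx.
Proof.
apply/is_hermitianmxP; rewrite expr0 scale1r.
apply/matrixP => i j; rewrite /coefs /sym2.
by case: k => -[|[|k]] ? /=; rewrite !mxE; case: i => -[|[|]]// ?;
  case: j => -[|[|]]// ? /=; rewrite ?conjC0 ?conjC1.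
Qed.

(** [sym2] is linear in its two arguments and the third coefficient is zero, so the complement of
    the two sets contributes nothing. *)
Lemma stepmx_parts A B z :
  stepmx coefs (parts A B) z = sym2 (\1_A z) (\1_B z).
Proof.
rewrite /stepmx !big_ord_recr big_ord0 /= add0r.
apply/matrixP => i j; rewrite /coefs /parts /sym2 /= !mxE.
by case: i => -[|[|]]// ?; case: j => -[|[|]]// ? /=;
  rewrite !(mulr0, mulr1, addr0, add0r).
Qed.

Lemma circle_integral0 : circle_integral (fun _ : R[i] => 0) = 0 :> R[i].
Proof.
rewrite /circle_integral /= /Rintegral integral0 /=; exact: erefl.
Qed.

Lemma fourier_parts A B n : fourier (stepmx coefs (parts A B)) n =
  sym2 (circle_integral (fun z => z ^ (- n) * \1_A z))
       (circle_integral (fun z => z ^ (- n) * \1_B z)).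
Proof.
apply/matrixP => i j; rewrite !mxE.
under eq_fun => z do rewrite stepmx_parts /sym2 !mxE.
by case: i => -[|[|]]// ?; case: j => -[|[|]]// ? /=;
  under eq_fun => z do rewrite ?mulr0; rewrite ?circle_integral0.
Qed.

(** The entry that matters is the upper right one, conj(a) b: its imaginary part p v - q u changes
    sign when the two arguments are exchanged. *)
Lemma sqabs_sym2 (p q u v : R) : sqabs (sym2 (p +i* q) (u +i* v)) =
  \matrix_(i, j) match val i, val j with
    | 0%N, 0%N => (p ^+ 2 + q ^+ 2 + u ^+ 2 + v ^+ 2) +i* 0
    | 0%N, _ => (p * u + q * v) +i* (p * v - q * u)
    | _, 0%N => (p * u + q * v) +i* (q * u - p * v)
    | _, _ => (u ^+ 2 + v ^+ 2) +i* 0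
  end.
Proof.
have conjE (x y : R) : Num.conj (x +i* y) = x -i* y by [].
apply/matrixP => i j; rewrite /sqabs !mxE !big_ord_recr big_ord0 /= add0r !mxE.
case: i => -[|[|]]// ?; case: j => -[|[|]]// ? /=.
all: rewrite ?conjC0 ?mulr0 ?mul0r ?addr0 ?add0r ?conjE.
all: simpc; congr (_ +i* _); ring.
Qed.

(** The nonemptiness hypotheses answer the clause of [partition] that every piece be nonempty. *)
Lemma measurable_partition_parts A B :
  measurable (A : set (borelC R)) -> measurable (B : set (borelC R)) ->
  A `<=` circle -> B `<=` circle -> A `&` B = set0 ->
  A !=set0 -> B !=set0 -> circle `\` (A `|` B) !=set0 ->
  measurable_partition (parts A B).
Proof.
move=> mA mB Ac Bc AB0 A0 B0 C0.
have disj z : A z -> B z -> False.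
  by move=> Az Bz; rewrite -[False]/(set0 z) -AB0.
split; last first.
  move=> [[|[|k]] kn] //; apply: measurableD; first exact: measurable_circle.
  exact: measurableU.
split.
- apply/seteqP; split => [z [k _]|z cz].
    by case: k => -[|[|k]] kn; rewrite /parts /=; [exact: Ac|exact: Bc|case].
  have [Az|nA] := pselect (A z); first by exists (@Ordinal 3 0 isT).
  have [Bz|nB] := pselect (B z); first by exists (@Ordinal 3 1 isT).
  by exists (@Ordinal 3 2 isT) => //=; split => //; case.
- move=> [[|[|[|//]]] kn] [[|[|[|//]]] ln] _ _ [z []] /= zk zl;
    apply: val_inj => //=; exfalso.
  + exact: disj zk zl.
  + by case: zl => _; apply; left.
  + exact: disj zl zk.
  + by case: zl => _; apply; right.
  + by case: zk => _; apply; left.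
  + by case: zk => _; apply; right.
- by move=> [[|[|k]] kn] _.
Qed.

Lemma arc_of_neq0 S a b : arc_of S a b -> S !=set0.
Proof.
move=> [_ _ /andP[a0 ab] b1 Sab]; exists (circle_param ((a + b) / 2)).
by apply/Sab; apply/andP; lra.
Qed.

Lemma circleD_quadrants_neq0 : circle `\` (quadrant1 `|` quadrant2) !=set0.
Proof.
(* The point 1 has imaginary part 0, so it lies in neither open quadrant. *)
exists (circle_param 0); split; first exact: circle_circle_param.
by case=> -[_ _]; rewrite /= mulr0 sin0 ltxx.
Qed.

Lemma quadrants_disjoint : quadrant1 `&` quadrant2 = set0.
Proof.
apply/seteqP; split => // z [[_ z1 _] [_ z2 _]].
by have := lt_trans z1 z2; rewrite ltxx.
Qed.

(** * Fourier coefficients of the quadrants *)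

Lemma circle_integral_quadrant1 (n : nat) : (0 < n)%N ->
  circle_integral (fun z => z ^ (- n%:Z) * \1_quadrant1 z) =
  (sin (pi / 2 * n%:R) / (2 * pi * n%:R)) +i*
  ((cos (pi / 2 * n%:R) - 1) / (2 * pi * n%:R)).
Proof.
move=> n0; rewrite (@circle_integral_arc _ _ _ _ arc_of_quadrant1 n0).
have -> : 2 * pi * n%:R * (1 / 4) = pi / 2 * n%:R :> R by field.
by rewrite mulr0 sin0 cos0 subr0.
Qed.

Lemma circle_integral_quadrant2 (n : nat) : (0 < n)%N ->
  circle_integral (fun z => z ^ (- n%:Z) * \1_quadrant2 z) =
  (- sin (pi / 2 * n%:R) / (2 * pi * n%:R)) +i*
  ((cos (pi * n%:R) - cos (pi / 2 * n%:R)) / (2 * pi * n%:R)).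
Proof.
move=> n0; rewrite (@circle_integral_arc _ _ _ _ arc_of_quadrant2 n0).
have -> : 2 * pi * n%:R * (1 / 4) = pi / 2 * n%:R :> R by field.
have -> : 2 * pi * n%:R * (1 / 2) = pi * n%:R :> R by field.
(* Only the sine is split: sin (n pi) is twice the vanishing product of sine and cosine at n pi / 2,
   while cos (n pi) stays. *)
have {1}-> : pi * n%:R = pi / 2 * n%:R + pi / 2 * n%:R :> R by field.
by rewrite sinD (mulrC (cos _)) sin_mul_cos_pihalf addr0 sub0r.
Qed.

(** The numerators of the coefficients are at most differences of two values in [-1, 1], hence the
    2, and 2 <= 2 pi. *)
Lemma norm_div_2pi_le (x : R) (n : nat) : (0 < n)%N -> `|x| <= 2 ->
  `|x / (2 * pi * n%:R)| <= n%:R^-1.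
Proof.
move=> n0 x2; have n0' : 0 < n%:R :> R by rewrite ltr0n.
have pi1 : 1 <= pi :> R by have := pi_ge2 R; lra.
have w0 : 0 < 2 * pi * n%:R :> R by rewrite !mulr_gt0//; lra.
rewrite normrM normfV (gtr0_norm w0) ler_pdivrMr//.
have -> : n%:R^-1 * (2 * pi * n%:R) = 2 * pi :> R by field; lra.
lra.
Qed.

Lemma cvgn_sum_sqabs_sym2 (a b : nat -> R[i]) (p q u v : nat -> R) :
  (forall n, (0 < n)%N -> a n = p n +i* q n) ->
  (forall n, (0 < n)%N -> b n = u n +i* v n) ->
  (forall n, (0 < n)%N -> [/\ `|p n| <= n%:R^-1, `|q n| <= n%:R^-1,
    `|u n| <= n%:R^-1 & `|v n| <= n%:R^-1]) ->
  cvgn (fun N => \sum_(1 <= n < N) sqabs (sym2 (a n) (b n))).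
Proof.
move=> aE bE bnd.
(* The constant 4 comes from the upper left entry, a sum of four products each at most 1 / n^2. *)
have bound n i j : (0 < n)%N ->
    `|complex.Re (sqabs (sym2 (a n) (b n)) i j)| <= 4 * n%:R ^- 2 /\
    `|complex.Im (sqabs (sym2 (a n) (b n)) i j)| <= 4 * n%:R ^- 2.
  move=> n0; have [ph qh uh vh] := bnd n n0.
  rewrite aE// bE// sqabs_sym2 mxE -exprVn !expr2.
  have prod_le (x y : R) : `|x| <= n%:R^-1 -> `|y| <= n%:R^-1 ->
      - (n%:R^-1 * n%:R^-1) <= x * y <= n%:R^-1 * n%:R^-1.
    by move=> xh yh; rewrite -ler_norml normrM ler_pM.
  move: (prod_le _ _ ph ph) (prod_le _ _ qh qh) (prod_le _ _ uh uh)
    (prod_le _ _ vh vh) (prod_le _ _ ph uh) (prod_le _ _ qh vh)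
    (prod_le _ _ ph vh) (prod_le _ _ qh uh).
  clear ph qh uh vh prod_le.
  (* With the products turned into variables, only linear inequalities remain. *)
  move: (n%:R^-1 * n%:R^-1) (p n * p n) (q n * q n) (u n * u n) (v n * v n)
    (p n * u n) (q n * v n) (p n * v n) (q n * u n)
    => h pp qq uu vv pu qv pv qu.
  move=> /andP[? ?] /andP[? ?] /andP[? ?] /andP[? ?].
  move=> /andP[? ?] /andP[? ?] /andP[? ?] /andP[? ?].
  by case: i => -[|[|]]// ?; case: j => -[|[|]]// ? /=; rewrite !ler_norml;
    split; apply/andP; split; lra.
by apply: (@cvgn_sum_mx _ 4) => n i j n0; have [] := bound n i j n0.
Qed.

Lemma fourier_partial_sum_parts A B N :
  fourier_partial_sum (stepmx coefs (parts A B)) N = \sum_(1 <= n < N)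
    sqabs (sym2 (circle_integral (fun z => z ^ (- n%:Z) * \1_A z))
                (circle_integral (fun z => z ^ (- n%:Z) * \1_B z))).
Proof. by apply: eq_bigr => n _; rewrite fourier_parts. Qed.

Let a (n : nat) : R[i] :=
  circle_integral (fun z => z ^ (- n%:Z) * \1_quadrant1 z).
Let b (n : nat) : R[i] :=
  circle_integral (fun z => z ^ (- n%:Z) * \1_quadrant2 z).

Lemma quadrant_bounds (n : nat) : (0 < n)%N ->
  [/\ `|sin (pi / 2 * n%:R) / (2 * pi * n%:R)| <= n%:R^-1 :> R,
      `|(cos (pi / 2 * n%:R) - 1) / (2 * pi * n%:R)| <= n%:R^-1 :> R,
      `|- sin (pi / 2 * n%:R) / (2 * pi * n%:R)| <= n%:R^-1 :> R &
      `|(cos (pi * n%:R) - cos (pi / 2 * n%:R)) / (2 * pi * n%:R)| <=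
        n%:R^-1 :> R].
Proof.
move=> n0.
have s1 (x : R) : -1 <= sin x <= 1 by rewrite -ler_norml sin_max.
have c1 (x : R) : -1 <= cos x <= 1 by rewrite -ler_norml cos_max.
have := s1 (pi / 2 * n%:R); have := c1 (pi / 2 * n%:R); have := c1 (pi * n%:R).
move=> /andP[? ?] /andP[? ?] /andP[? ?].
by split; apply: norm_div_2pi_le => //; rewrite ler_norml; apply/andP; lra.
Qed.

Lemma Im_sqabs_quadrants (n : nat) : (0 < n)%N ->
  complex.Im (sqabs (sym2 (a n) (b n)) 0 1) =
    - (2 * pi ^+ 2)^-1 * (sin (pi / 2 * n%:R) / n%:R ^+ 2) /\
  complex.Im (sqabs (sym2 (b n) (a n)) 0 1) =
    (2 * pi ^+ 2)^-1 * (sin (pi / 2 * n%:R) / n%:R ^+ 2).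
Proof.
move=> n0; have n0' : n%:R != 0 :> R by rewrite pnatr_eq0 -lt0n.
have pi0 : pi != 0 :> R by rewrite gt_eqF// pi_gt0.
rewrite /a /b circle_integral_quadrant1// circle_integral_quadrant2//.
rewrite !sqabs_sym2 !mxE /=.
have -> : pi * n%:R = pi / 2 * n%:R + pi / 2 * n%:R :> R by field.
have := sin_mul_cos_pihalf n; have := cos2Dsin2 (pi / 2 * n%:R : R).
rewrite cosD.
move: (sin _) (cos _) => s c cs1 sc0; clear n0.
move: (pi : R) (n%:R : R) pi0 n0' => P w P0 w0.
(* Here s and c are the sine and cosine of n pi / 2, and cos (n pi) is expanded as c^2 - s^2. The
   left side of [H] is the numerator of p v - q u; it collapses by s c = 0 and c^2 + s^2 = 1. *)
suff H : s * (c * c - s * s - c) - (c - 1) * (- s) = - (2 * s).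
  split; last first.
    transitivity (- (s * (c * c - s * s - c) - (c - 1) * (- s)) /
                  (2 * P * w) ^+ 2).
      by field; rewrite ?w0 ?P0.
    by rewrite H; field; rewrite ?w0 ?P0.
  transitivity ((s * (c * c - s * s - c) - (c - 1) * (- s)) / (2 * P * w) ^+ 2).
    by field; rewrite ?w0 ?P0.
  by rewrite H; field; rewrite ?w0 ?P0.
have -> : s * (c * c - s * s - c) - (c - 1) * - s =
   2 * (s * c) * c - s * (c ^+ 2 + s ^+ 2) - s by ring.
by rewrite sc0 cs1; ring.
Qed.

(** * Convergence of the two sums and their difference *)

Lemma cvgn_quadrants12 :
  cvgn (fun N => \sum_(1 <= n < N) sqabs (sym2 (a n) (b n))).
Proof.
exact: cvgn_sum_sqabs_sym2 circle_integral_quadrant1 circle_integral_quadrant2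
  quadrant_bounds.
Qed.

Lemma cvgn_quadrants21 :
  cvgn (fun N => \sum_(1 <= n < N) sqabs (sym2 (b n) (a n))).
Proof.
apply: cvgn_sum_sqabs_sym2 circle_integral_quadrant2
  circle_integral_quadrant1 _.
by move=> n n0; have [] := quadrant_bounds n n0.
Qed.

(** A common limit of [u] and its opposite is 0, yet the bound from index 3 on keeps it at least c >
    0. *)
Lemma cvgn_gt0_oppr_absurd (u : nat -> R) (c m : R) : 0 < c ->
  (forall N, c <= u N.+3) -> u @ \oo --> m -> - u N @[N --> \oo] --> m -> False.
Proof.
move=> c0 cu um Num; have cm : c <= m.
  apply: (cvgr_to_ge um); exists 3 => //= -[|[|[|N]]]//= _.
have um' : u N @[N --> \oo] --> - m.
  by rewrite (_ : u = fun N => - - u N);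
    [exact: cvgN|apply/funext => N; rewrite opprK].
have := cvg_lim (@norm_hausdorff _ R) um.
rewrite (cvg_lim (@norm_hausdorff _ R) um') => /(_ _) E.
by move: cm c0; rewrite -E; lra.
Qed.

Lemma lim_quadrants_neq :
  limn (fun N => \sum_(1 <= n < N) sqabs (sym2 (a n) (b n))) <>
  limn (fun N => \sum_(1 <= n < N) sqabs (sym2 (b n) (a n))).
Proof.
have entry (F : nat -> 'M[R[i]]_2) : cvgn F ->
    complex.Im (F N 0 1) @[N --> \oo] --> complex.Im (limn F 0 1).
  move=> /cvgn_mx_entry-/(_ 0 1) cF.
  apply: (cvg_comp (fun N => F N 0 1) (@complex.Im R) cF).
  exact: continuous_Im.
have := entry _ cvgn_quadrants12; have := entry _ cvgn_quadrants21.
(* If the limits were equal, the upper right imaginary parts [T] and [- T] of the partial sums would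
   share the limit [m]. *)
move=> + + E; rewrite -E.
set m := complex.Im _.
pose T N : R :=
  (2 * pi ^+ 2)^-1 * \sum_(1 <= n < N) (sin (pi / 2 * n%:R) / n%:R ^+ 2).
have -> : (fun N => complex.Im
    ((\sum_(1 <= n < N) sqabs (sym2 (b n) (a n))) 0 1)) = T.
  apply/funext => N; rewrite summxE raddf_sum /T mulr_sumr.
  apply: eq_big_nat => n /andP[n0 _].
  by have [] := Im_sqabs_quadrants n n0.
have -> : (fun N => complex.Im
    ((\sum_(1 <= n < N) sqabs (sym2 (a n) (b n))) 0 1)) = (fun N => - T N).
  apply/funext => N; rewrite summxE raddf_sum /T -mulNr mulr_sumr.
  apply: eq_big_nat => n /andP[n0 _].
  by have [] := Im_sqabs_quadrants n n0.
move=> Tm NTm; have k0 : 0 < (2 * pi ^+ 2)^-1 :> R.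
  by rewrite invr_gt0 mulr_gt0 ?exprn_gt0 ?pi_gt0.
(* The factor 1 / 2 is the lower bound of the sine sums once the positive term 1 / (N + 2) is
   dropped. *)
apply: (@cvgn_gt0_oppr_absurd _ ((2 * pi ^+ 2)^-1 * (1 / 2)) _ _ _ Tm NTm).
  by rewrite mulr_gt0.
move=> N; rewrite /T (ler_pM2l k0); apply: le_trans (sum_sin_pihalf_ge _).
by rewrite lerDl invr_ge0.
Qed.
End Circle.

Theorem theorem3p1 (R : realType) :
  exists (S S' : 'I_3 -> set R[i]) (D : 'I_3 -> 'M[R[i]]_2),
    [/\ measurable_partition S,
        measurable_partition S',
        S <> S',
        (forall k, arc_measure (S k) = arc_measure (S' k)) &
        (forall k, D k \is hermsymmx)] /\
    [/\ cvgn (fourier_partial_sum (stepmx D S)),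
        cvgn (fourier_partial_sum (stepmx D S')) &
        limn (fourier_partial_sum (stepmx D S)) <>
        limn (fourier_partial_sum (stepmx D S'))].
Proof.
have arc1 := @arc_of_quadrant1 R; have arc2 := @arc_of_quadrant2 R.
have [m1 c1 _ _ _] := arc1; have [m2 c2 _ _ _] := arc2.
exists (parts quadrant1 quadrant2), (parts quadrant2 quadrant1), coefs.
split; split.
- apply: measurable_partition_parts => //.
  + exact: quadrants_disjoint.
  + exact: arc_of_neq0 arc1.
  + exact: arc_of_neq0 arc2.
  + exact: circleD_quadrants_neq0.
- apply: measurable_partition_parts => //.
  + by rewrite setIC quadrants_disjoint.
  + exact: arc_of_neq0 arc2.
  + exact: arc_of_neq0 arc1.
  + by rewrite setUC; exact: circleD_quadrants_neq0.
(* Equality at index 0 would identify two disjoint nonempty quadrants. *)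
- move=> /(congr1 (fun S => S (@Ordinal 3 0 isT))); rewrite /parts /= => E.
  have [z z1] := arc_of_neq0 _ _ _ arc1.
  suff : (quadrant1 `&` quadrant2) z by rewrite quadrants_disjoint.
  by split; [|rewrite -E].
(* Both quadrants have measure 1/4; the third sets coincide by commutativity of the union. *)
- have E : arc_measure (quadrant1 : set R[i]) = arc_measure quadrant2.
    rewrite (arc_measure_arc _ _ _ arc1) (arc_measure_arc _ _ _ arc2).
    by congr (_%:E); field.
  by move=> [[|[|k]] kn]; rewrite /parts /= ?E// setUC.
- exact: coefs_hermsym.
- by rewrite (funext (fourier_partial_sum_parts _ _)); exact: cvgn_quadrants12.
- by rewrite (funext (fourier_partial_sum_parts _ _)); exact: cvgn_quadrants21.
- by rewrite !(funext (fourier_partial_sum_parts _ _));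
  exact: lim_quadrants_neq.
Qed.
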